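(* Assume the Continuum Hypothesis. Then for every ordinal $\alpha$ with $1\le\alpha\le\omega_1$ the class $\mathcal{P}_\alpha$ is nonempty.
   Context: A filter on $A\subseteq\omega$ is identified with the filter on $\omega$ it generates. A cascade is a tree $V$ without infinite branches and with least element $\emptyset_V$; $v^+$ is the set of immediate successors, $v^\uparrow$ the subcascade of $v$ and everything above it; $V$ is sequential if each non-maximal $v^+$ is countably infinite. Ranks: $r(v)=0$ for maximal $v$, else least ordinal greater than all $r(w)$, $w\in v^+$; $r(V)=r(\emptyset_V)$. Monotone: each $v^+$ can be enumerated with non-decreasing ranks. The contour $\int V$: principal at $v$ for maximal $v$; otherwise $\int v^\uparrow=\{A: A\cap\max v_k^\uparrow\in\int v_k^\uparrow$ for all but finitely many $k\}$; $\int V=\int\emptyset_V^\uparrow$. A monotone sequential contour of rank $\alpha$ is $\int V$ (as a filter on $\omega$) for a monotone sequential cascade $V$ of rank $\alpha$ with $\max V\subseteq\omega$. For $1\le\alpha<\omega_1$, $\mathcal{P}_\alpha$ is the class of ultrafilters on $\omega$ containing no monotone sequential contour of rank $\alpha$ but one of each rank $1\le\beta<\alpha$; $\mathcal{P}_{\omega_1}$ is the class of ultrafilters on $\omega$ containing a monotone sequential contour of every countable rank. *)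

(* Defs.v *)
From mathcomp Require Import all_boot.
From mathcomp Require Import boolp classical_sets functions cardinality filter.
From Stdlib Require Import Relation_Definitions.

Set Implicit Arguments.
Unset Strict Implicit.
Unset Printing Implicit Defensive.

Local Open Scope classical_set_scope.
Local Open Scope card_scope.

Definition continuum_hypothesis : Prop :=
  forall A : set (set nat), countable A \/ A #= [set: set nat].

(** * Ordinals *)

(** Ordinals are represented by well-founded trees: [osup f] denotes the least
    ordinal strictly greater than every [f i] (see [osup_gt], [osup_least]).
    Distinct trees may denote the same ordinal: equality of ordinals is [oeq],
    not Leibniz equality. *)
Inductive Ord : Type := osup (I : Type) (f : I -> Ord).

Fixpoint ole (a b : Ord) : Prop :=
  match a, b with
  | osup K f, osup J g => forall i : K, exists j : J, ole (f i) (g j)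
  end.

Definition olt (a b : Ord) : Prop :=
  match b with osup J g => exists j : J, ole a (g j) end.

Definition oeq (a b : Ord) : Prop := ole a b /\ ole b a.

Definition ozero : Ord := osup (of_void Ord).

Definition oone : Ord := osup (fun _ : unit => ozero).

(** Strict suprema of sequences generate exactly the nonzero countable
    ordinals, so that the strict supremum of all the [ord_of_code c] is the
    first uncountable ordinal (proved in [omega1P]). *)
Inductive countable_code : Type :=
  | code_zero
  | code_sup (s : nat -> countable_code).

Fixpoint ord_of_code (c : countable_code) : Ord :=
  match c with
  | code_zero => ozero
  | code_sup s => osup (fun n => ord_of_code (s n))
  end.

Definition omega1 : Ord := osup ord_of_code.

(** The set of ordinals smaller than [a] is countable. *)
Definition countable_ordinal (a : Ord) : Prop :=
  exists e : nat -> Ord, forall b, olt b a -> exists n, oeq b (e n).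

Lemma ole_refl a : ole a a.
Proof. by elim: a => I f IH /= i; exists i. Qed.

Lemma ole_trans b a c : ole a b -> ole b c -> ole a c.
Proof.
elim: a b c => I f IH [J g] [K h] /= fg gh i.
by have [j fgj] := fg i; have [k ghk] := gh j; exists k; apply: IH ghk.
Qed.

Lemma olt_ole a b : olt a b -> ole a b.
Proof.
elim: a b => I f IH [J g] /= [j]; case E: (g j) => [K h] /= fh i.
by exists j; apply: IH; rewrite E; have [k ?] := fh i; exists k.
Qed.

Lemma ole_olt_trans b a c : ole a b -> olt b c -> olt a c.
Proof. by case: c => K h ab /= [k bk]; exists k; apply: ole_trans bk. Qed.

Lemma olt_ole_trans b a c : olt a b -> ole b c -> olt a c.
Proof.
case: b c => J g [K h] /= [j aj] gh.
by have [k gk] := gh j; exists k; apply: ole_trans gk.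
Qed.

Lemma olt_irrefl a : ~ olt a a.
Proof.
elim: a => I f IH /= [i le_i]; apply: (IH i).
by apply: (@olt_ole_trans (osup f)) => //=; exists i; apply: ole_refl.
Qed.

Lemma ole_total a b : ole a b \/ olt b a.
Proof.
elim: a b => I f IH b; have [?|nle] := pselect (ole (osup f) b); first by left.
right=> /=; apply: contrapT => nex; apply: nle; case: b nex => J g nex /= i.
have [le_fi|//] : ole (osup g) (f i) \/ olt (f i) (osup g).
  suff: forall b, ole b (f i) \/ olt (f i) b by apply.
  elim=> K h IHh; have [?|nle] := pselect (ole (osup h) (f i)); first by left.
  right=> /=; apply: contrapT => nexk; apply: nle.
  case E: (f i) => [L l] /= k; have [le_k|//] := IH i (h k).
    by case: nexk; exists k.
  by rewrite E.
by case: nex; exists i.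
Qed.

Lemma olt_wf : well_founded olt.
Proof.
suff H a b : ole b a -> Acc olt b by move=> a; apply: (H a); apply: ole_refl.
elim: a b => I f IH b le_b; constructor=> c /olt_ole_trans /(_ le_b) /= [i].
exact: IH.
Qed.

Lemma osup_gt (I : Type) (f : I -> Ord) i : olt (f i) (osup f).
Proof. by exists i; apply: ole_refl. Qed.

Lemma osup_least (I : Type) (f : I -> Ord) b :
  (forall i, olt (f i) b) -> ole (osup f) b.
Proof. by case: b. Qed.

Lemma countable_ord_of_code c : countable_ordinal (ord_of_code c).
Proof.
elim: c => [|s IH]; first by exists (fun=> ozero) => b /= [[]].
have [e eP] := choice IH.
exists (fun k => if @unpickle (option nat * nat)%type k is Some (m, n)
                 then if m is Some m then e n m else ord_of_code (s n)
                 else ozero) => b /= [n le_b].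
have [le_n|/eP[m bm]] := ole_total (ord_of_code (s n)) b.
  by exists (pickle (@None nat, n)); rewrite pickleK.
by exists (pickle (Some m, n)); rewrite pickleK.
Qed.

Lemma omega1P a : countable_ordinal a <-> olt a omega1.
Proof.
split=> [[e eP]|[c le_c]]; last first.
  have [e eP] := countable_ord_of_code c; exists e => b lt_b.
  by apply: eP; apply: olt_ole_trans le_c.
have [le_a|//] := ole_total omega1 a; exfalso.
have /choice[s sP] n : exists c, olt (e n) omega1 -> ole (e n) (ord_of_code c).
  have [[c ?]|?] := pselect (olt (e n) omega1); first by exists c.
  by exists code_zero.
have lt_s : olt (ord_of_code (code_sup s)) omega1 by apply: osup_gt.
have [n [le1 le2]] := eP _ (olt_ole_trans lt_s le_a).
apply: (@olt_irrefl (e n)).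
apply: (@ole_olt_trans (ord_of_code (s n))); first exact/sP/(ole_olt_trans le2).
by apply: olt_ole_trans le1; exists n; apply: ole_refl.
Qed.

(** * Cascades *)

Definition is_branch (T : Type) (R : relation T) (B : set T) : Prop :=
  total_on B R /\ forall C : set T, total_on C R -> B `<=` C -> C = B.

Record cascade : Type := Cascade {
  node :> Type;
  below : relation node;
  least_node : node;
  below_order : order node below;
  (* the elements below any given one are well-ordered *)
  below_tree : forall (v : node) (A : set node),
    A `<=` [set w | below w v] -> A !=set0 ->
    exists2 m, A m & forall w, A w -> below m w;
  least_nodeP : forall v, below least_node v;
  branch_finite : forall B, is_branch below B -> finite_set B
}.

Section CascadeNotions.
Variable V : cascade.
Implicit Types (v w : V) (r : V -> Ord) (l : V -> nat).

Definition strictly_below v w : Prop := below v w /\ v <> w.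

Definition maximal_nodes : set V := [set v | forall w, below v w -> w = v].

Definition successors v : set V :=
  [set w | strictly_below v w /\
           ~ exists u, strictly_below v u /\ strictly_below u w].

Definition sequential : Prop :=
  forall v, ~ maximal_nodes v -> successors v #= [set: nat].

Definition is_least_above (S : set V) r (a : Ord) : Prop :=
  (forall w, S w -> olt (r w) a) /\
  (forall b, (forall w, S w -> olt (r w) b) -> ole a b).

Definition is_rank r : Prop := forall v,
  (maximal_nodes v -> oeq (r v) ozero) /\
  (~ maximal_nodes v -> is_least_above (successors v) r (r v)).

Definition has_rank (a : Ord) : Prop :=
  exists2 r, is_rank r & oeq (r (least_node V)) a.

Definition monotone : Prop :=
  exists2 r, is_rank r & forall v, ~ maximal_nodes v ->
    exists2 e : nat -> V, set_bij [set: nat] (successors v) e &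
      forall m n : nat, m <= n -> ole (r (e m)) (r (e n)).

(** The inclusion of [max V] in omega is rendered by a labelling [l] of the
    nodes which is injective on the maximal ones (the labels of the other nodes
    are irrelevant); a maximal node is identified with its label. *)
Definition max_above l v : set nat :=
  [set l w | w in [set w | maximal_nodes w /\ below v w]].

(** [contour_at l v] is the filter on omega generated by the contour of the
    subcascade of the nodes above [v]; [E] is the finite exceptional set of
    immediate successors. *)
Inductive contour_at l : V -> set_system nat :=
  | contour_maximal v (A : set nat) :
      maximal_nodes v -> A (l v) -> contour_at l v A
  | contour_node v (A : set nat) (E : set V) :
      ~ maximal_nodes v -> finite_set E ->
      (forall w, successors v w -> ~ E w ->
         contour_at l w (A `&` max_above l w)) ->
      contour_at l v A.

Definition contour l : set_system nat := contour_at l (least_node V).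

End CascadeNotions.

Definition is_monotone_sequential_contour (a : Ord) (F : set_system nat) :
    Prop :=
  exists (V : cascade) (l : V -> nat),
    [/\ sequential V, monotone V, has_rank V a,
        {in @maximal_nodes V &, injective l} & F = contour l].

(** * The classes P_alpha *)

Definition contains_contour (U : set_system nat) (a : Ord) : Prop :=
  exists2 F, is_monotone_sequential_contour a F & F `<=` U.

Definition P_countable (a : Ord) : set (set_system nat) :=
  [set U | [/\ UltraFilter U, ~ contains_contour U a &
    forall b, ole oone b -> olt b a -> contains_contour U b]].

(** "Every countable rank" means every rank at least 1: a rank 0 contour is a
    principal ultrafilter, and no ultrafilter containing one contains a contour
    of rank 1. *)
Definition P_omega1 : set (set_system nat) :=
  [set U | UltraFilter U /\
    forall b, ole oone b -> olt b omega1 -> contains_contour U b].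

Definition P_class (a : Ord) : set (set_system nat) :=
  [set U | (olt a omega1 /\ P_countable a U) \/ (oeq a omega1 /\ P_omega1 U)].

(* Main.v *)
Require Import Defs.
From mathcomp Require Import all_boot.
From mathcomp Require Import boolp classical_sets functions cardinality filter.
From mathcomp Require wochoice.

(** The contours of ranks [b], [1 <= b < omega1], can be chosen increasing: the
    contour of rank [b] is the limit of copies, on disjoint sets, of contours of
    ranks [b_n], where [b_n] is non-decreasing with strict supremum [b]; if
    [b < c] then [b_n < b <= c_n] for almost all [n]. An ultrafilter above all of
    them is in [P_omega1].

    For [a < omega1] let [F] be the union of an increasing sequence of such
    contours of ranks smaller than [a] (of a principal ultrafilter if [a = 1]).
    Even after countably many sets have been added, [F] contains no contour [G]
    of rank [a]: if [G] is the limit of contours [G_k] carried by disjoint sets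
    [B_k], and the sets [A n], decreasing and positive, miss the first [n] of the
    [B_k], then induction on a contour of smaller rank yields a set that meets
    every [A n] in a positive set while its complement belongs to [G]. Under CH
    all contours of rank [a] can thus be killed one at a time in [omega1] steps,
    only countably many sets having been added before each step. *)

Set Implicit Arguments.
Unset Strict Implicit.
Unset Printing Implicit Defensive.

Local Open Scope classical_set_scope.

Lemma oltW_trans b a c : olt a b -> olt b c -> olt a c.
Proof. by move=> /olt_ole; apply: ole_olt_trans. Qed.

Lemma olt_osup (I : Type) (f : I -> Ord) a : olt a (osup f) -> exists i, ole a (f i).
Proof. by []. Qed.

(** * Trees of labels *)

(** A normal form of labelled sequential cascades: successors come enumerated, so finite exceptional
    sets become initial segments of [nat]. *)
Inductive tree : Type := leaf (x : nat) | fan (s : nat -> tree).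

Fixpoint rk (t : tree) : Ord :=
  if t is fan s then osup (fun n => rk (s n)) else ozero.

Fixpoint leaves (t : tree) : set nat :=
  match t with
  | leaf x => [set x]
  | fan s => [set x | exists n, leaves (s n) x]
  end.

(** Every branch carries a filter on the whole of omega, so no trace on its leaves is taken;
    [tcontour_leaves] recovers it. *)
Fixpoint tcontour (t : tree) : set_system nat :=
  match t with
  | leaf x => [set A | A x]
  | fan s => [set A | exists N, forall n, N <= n -> tcontour (s n) A]
  end.

(** The ideal dual to the contour; a set that is not null is positive. *)
Definition null (t : tree) (A : set nat) : Prop := tcontour t (~` A).

Fixpoint inj_leaves (t : tree) : Prop :=
  if t is fan s then
    (forall n, inj_leaves (s n)) /\
    (forall m n x, leaves (s m) x -> leaves (s n) x -> m = n)
  else True.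

Fixpoint mono_rk (t : tree) : Prop :=
  if t is fan s then
    (forall n, mono_rk (s n)) /\
    (forall m n, m <= n -> ole (rk (s m)) (rk (s n)))
  else True.

Lemma tcontourS t A B : A `<=` B -> tcontour t A -> tcontour t B.
Proof.
move=> AB; elim: t => [x /AB|s IH /= [N sA]] //.
by exists N => n /sA; apply: IH.
Qed.

Lemma tcontourI t A B : tcontour t A -> tcontour t B -> tcontour t (A `&` B).
Proof.
elim: t => [x|s IH] //= [M sA] [N sB]; exists (maxn M N) => n.
by rewrite geq_max => /andP[/sA ? /sB ?]; apply: IH.
Qed.

Lemma tcontour_leaves t : tcontour t (leaves t).
Proof.
elim: t => [x|s IH] //=; exists 0 => n _.
by apply: tcontourS (IH n) => x sx; exists n.
Qed.

Lemma tcontour0 t : ~ tcontour t set0.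
Proof. by elim: t => [x|s IH] //= [N /(_ N (leqnn N))]; apply: IH. Qed.

#[global] Instance tcontour_proper t : ProperFilter (tcontour t).
Proof.
split; first exact: tcontour0.
split; [|exact: tcontourI|exact: tcontourS].
by apply: tcontourS (tcontour_leaves t).
Qed.

Lemma null_sub t A B : A `<=` B -> null t B -> null t A.
Proof. by move=> AB; apply: tcontourS; apply: subsetC. Qed.

Lemma nullU t A B : null t A -> null t B -> null t (A `|` B).
Proof. by rewrite /null setCU; apply: tcontourI. Qed.

Lemma null_disj t A : A `&` leaves t = set0 -> null t A.
Proof.
move=> A0; apply: tcontourS (tcontour_leaves t) => x tx Ax.
by have : (A `&` leaves t) x by []; rewrite A0.
Qed.

Lemma null_fin t (A : nat -> set nat) n :
  (forall i, i < n -> null t (A i)) -> null t [set x | exists2 i, i < n & A i x].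
Proof.
elim: n => [|n IH] nA; first by apply: null_disj; rewrite -subset0 => x [[]].
apply: (@null_sub _ _ ([set x | exists2 i, i < n & A i x] `|` A n)).
  move=> x [i]; rewrite ltnS leq_eqVlt => /predU1P[-> ?|ltin Aix]; first by right.
  by left; exists i.
by apply: nullU; [apply: IH => i /ltnW|]; exact: nA.
Qed.

(** * Diagonalization against a contour *)

Section Diagonal.
Variable w : nat -> tree.
Hypothesis w_inj : inj_leaves (fan w).

Lemma null_below n : null (fan w) [set x | exists2 k, k < n & leaves (w k) x].
Proof.
exists n => m len; apply: null_disj; rewrite -subset0 => x [[k ltkn wkx] wmx].
by move: w_inj => [_ /(_ _ _ _ wkx wmx) E]; move: ltkn; rewrite E ltnNge len.
Qed.

(* The sequence [A] leaves each [leaves (w k)] eventually, so that only finitely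
   many of the sets [Y j `&` A (p j)] meet it. *)
Lemma null_glue (A Y : nat -> set nat) (p : nat -> nat) :
  (forall k n, k < n -> A n `&` leaves (w k) = set0) ->
  (forall j, j <= p j) ->
  (forall j k, p j <= k -> null (w k) (Y j)) ->
  null (fan w) [set x | exists j, (Y j `&` A (p j)) x].
Proof.
move=> A0 lep nY; exists 0 => k _.
pose Z j := Y j `&` A (p j).
have nZ j : null (w k) (Z j).
  have [/nY|/A0 A0k] := leqP (p j) k; first by apply: null_sub => x [].
  apply: null_disj; rewrite -subset0 => x [[_ Ax] wx].
  by rewrite -A0k.
apply: (@null_sub _ _ ([set x | exists2 i, i < k.+1 & Z i x] `|` ~` leaves (w k))).
  move=> x [j Zx]; have [ltjk|gtjk] := ltnP j k.+1; first by left; exists j.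
  right => wx; have : (A (p j) `&` leaves (w k)) x by split=> //; case: Zx.
  by rewrite A0 // (leq_trans gtjk).
apply: nullU; first exact: null_fin.
by apply: null_disj; rewrite -subset0 => x [].
Qed.

End Diagonal.

(** [w] is quantified inside: the induction on [t] plays a branch of [t] against [w] and also
    against single branches of [w]. *)
Definition diagonalizes (t : tree) : Prop :=
  forall w, inj_leaves (fan w) -> mono_rk (fan w) ->
  olt (rk t) (rk (fan w)) ->
  forall A : nat -> set nat,
  (forall n, A n.+1 `<=` A n) -> (forall n, ~ null t (A n)) ->
  (forall k n, k < n -> A n `&` leaves (w k) = set0) ->
  exists2 Y, null (fan w) Y & forall n, ~ null t (Y `&` A n).

Lemma decreasing_leq (A : nat -> set nat) m n :
  (forall n, A n.+1 `<=` A n) -> m <= n -> A n `<=` A m.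
Proof.
move=> dA; elim: n => [|n IH]; first by rewrite leqn0 => /eqP->.
by rewrite leq_eqVlt => /predU1P[->//|/IH]; apply: subset_trans.
Qed.

(** If [A] is positive on the first [n] branches of [w], that part is already null for [w].
    Otherwise [A] stays positive when these branches are removed, and [diagonalizes] applies. *)
Lemma diagonalizes_split t w A : diagonalizes t ->
  inj_leaves w -> mono_rk w -> olt (rk t) (rk w) -> ~ null t A ->
  exists Y, [/\ Y `<=` A, null w Y & ~ null t Y].
Proof.
case: w => [x|w] Dt iw mw ltw pA; first by case: ltw => - [].
pose B n := [set x | exists2 k, k < n & leaves (w k) x].
have [[n pB]|npB] := pselect (exists n, ~ null t (A `&` B n)).
  exists (A `&` B n); split=> //; apply: null_sub (null_below iw n).
  exact: subIsetr.
have nB n : null t (A `&` B n) by apply: contrapT => pB; apply: npB; exists n.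
have [||k n ltkn|Y nY pY] := Dt w iw mw ltw (fun n => A `\` B n).
- move=> n x [Ax nBx]; split=> // - [k ltk wx]; apply: nBx.
  by exists k => //; apply: leqW.
- move=> n nD; apply: pA; apply: null_sub (nullU (nB n) nD) => x Ax.
  by have [Bx|nBx] := pselect (B n x); [left|right].
- by rewrite -subset0 => x [[_ nBx] wx]; apply: nBx; exists k.
exists (Y `&` A); split; first exact: subIsetr.
  by apply: null_sub nY; apply: subIsetl.
by move: (pY 0) => /[swap] nYA; apply; apply: null_sub nYA => x [Yx []].
Qed.

(** Positive for [fan v] means positive for infinitely many [v m]. For each [j] a piece is found
    that is positive for some [v m] with [j <= m] and null for almost all [w k]; [null_glue]
    assembles the pieces. *)
Lemma tree_diagonalizes t : diagonalizes t.
Proof.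
elim: t => [x|v IH] w iw mw ltw A dA pA A0.
  have Ax n : A n x by apply: contrapT => ?; apply: (pA n).
  (* Every [A n] contains the leaf [x], while [A k.+1] misses [leaves (w k)]. *)
  exists [set x] => [|n []//]; exists 0 => k _.
  apply: null_disj; rewrite -subset0 => y [-> wx].
  by rewrite -(A0 k k.+1 (ltnSn k)).
(* From [j0] on, the [w k] have at least the rank of [fan v], which exceeds that of every [v m]. *)
have [j0 lev] := olt_osup ltw.
have lew k m : j0 <= k -> olt (rk (v m)) (rk (w k)).
  move=> lek; apply: olt_ole_trans (proj2 mw _ _ lek).
  by apply: olt_ole_trans lev; apply: osup_gt.
have [iws djw] := iw; have [mws _] := mw.
(* If [A i] is positive on some [leaves (w k)], split there: the rank of [w k]
   exceeds that of [v m]. Otherwise the induction hypothesis applies to [fan w]. *)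
have piece j : exists mY : nat * set nat,
    [/\ j <= mY.1, mY.2 `<=` A (maxn j j0), ~ null (v mY.1) mY.2 &
       forall k, maxn j j0 <= k -> null (w k) mY.2].
  set i := maxn j j0.
  have [m lejm pm] : exists2 m, j <= m & ~ null (v m) (A i).
    apply: contrapT => nm; apply: (pA i); exists j => m lejm.
    by apply: contrapT => pm; apply: nm; exists m.
  have [[k pk]|npk] := pselect (exists k, ~ null (v m) (A i `&` leaves (w k))).
    have leik : i <= k.
      rewrite leqNgt; apply/negP => /A0 E; apply: pk; rewrite E /null setC0.
      exact: filterT.
    have [|Y [YA nY pY]] := diagonalizes_split (IH m) (iws k) (mws k) _ pk.
      by apply: lew; apply: leq_trans leik; apply: leq_maxr.
    exists (m, Y); split=> //= [x /YA[]//|k' _].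
    have [->//|nekk'] := pselect (k' = k).
    apply: null_disj; rewrite -subset0 => x [/YA[_ wx] wx'].
    by apply: nekk'; apply: djw wx' wx.
  pose B n := [set x | exists2 k, k < n & leaves (w k) x].
  have nB n : null (v m) (A i `&` B n).
    have nk k : k < n -> null (v m) (A i `&` leaves (w k)).
      by move=> _; apply: contrapT => pk; apply: npk; exists k.
    apply: null_sub (null_fin nk) => x [Ax [k ltk wx]]; by exists k.
  have lt_m : olt (rk (v m)) (rk (fan w)).
    by apply: oltW_trans ltw; apply: osup_gt.
  have [||k n ltkn|Y [q nY] pY] := IH m w iw mw lt_m (fun n => A i `\` B n).
  - move=> n x [Ax nBx]; split=> // - [k ltk wx]; apply: nBx.
    by exists k => //; apply: leqW.
  - move=> n nD; apply: pm; apply: null_sub (nullU (nB n) nD) => x Ax.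
    by have [Bx|nBx] := pselect (B n x); [left|right].
  - by rewrite -subset0 => x [[_ nBx] wx]; apply: nBx; exists k.
  (* [Y] is null for [w k] when [q <= k]; off [B q] it misses the earlier branches. *)
  exists (m, Y `&` (A i `\` B q)); split=> //= [x [_ []]//|k _].
  have [/nY|ltkq] := leqP q k; first by apply: null_sub => x [].
  apply: null_disj; rewrite -subset0 => x [[_ [_ nBx]] wx].
  by apply: nBx; exists k.
have /choice[f fP] := piece.
exists [set x | exists j, ((f j).2 `&` A (maxn j j0)) x].
  apply: (null_glue (p := fun j => maxn j j0) A0) => j; first exact: leq_maxl.
  by move=> k; have [_ _ _] := fP j; apply.
(* The piece of index [maxn n N] lies in [A n] and is positive for some [v m] with [N <= m]. *)
move=> n [N nN].
have [lej fA pf _] := fP (maxn n N).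
apply: pf; have := nN (f (maxn n N)).1 (leq_trans (leq_maxr _ _) lej).
apply: null_sub => x fx; split; first by exists (maxn n N); split=> //; apply: fA.
by move/fA: fx; apply: decreasing_leq => //; rewrite -maxnA leq_maxl.
Qed.

Lemma increasing_leq (T : Type) (A : nat -> set T) :
  (forall n, A n `<=` A n.+1) -> forall m n, m <= n -> A m `<=` A n.
Proof.
move=> iA m; elim=> [|n IH]; first by rewrite leqn0 => /eqP->.
rewrite leq_eqVlt => /predU1P[->//|/IH mn]; exact: subset_trans (iA n).
Qed.

(** Positive for all [t j] means positive for the union of the chain of contours. Each [t j] gets
    its own diagonal set, and these countably many sets are glued. *)
Lemma diagonal_union (t : nat -> tree) w (A : nat -> set nat) :
  (forall j, tcontour (t j) `<=` tcontour (t j.+1)) ->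
  inj_leaves w -> mono_rk w -> (forall j, olt (rk (t j)) (rk w)) ->
  (forall n, A n.+1 `<=` A n) -> (forall j n, ~ null (t j) (A n)) ->
  exists2 Y, null w Y & forall j n, ~ null (t j) (Y `&` A n).
Proof.
move=> ct iw mw ltw dA pA; case: w iw mw ltw => [x|w] iw mw ltw.
  by case: (ltw 0) => - [].
pose B n := [set x | exists2 k, k < n & leaves (w k) x].
have ct_leq := increasing_leq ct.
have [[n pB]|npB] := pselect (exists n, forall j m, ~ null (t j) (B n `&` A m)).
  by exists (B n) => //; apply: null_below.
have pD j n : ~ null (t j) (A n `\` B n).
  (* Otherwise both parts of some [A] would be null for the later of [t i] and [t j]. *)
  move=> nD; apply: npB; exists n => i m nB.
  apply: (pA (maxn i j) (maxn m n)).
  have {}nB := ct_leq _ _ (leq_maxl i j) _ nB.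
  have {}nD := ct_leq _ _ (leq_maxr i j) _ nD.
  apply: null_sub (nullU nB nD) => x Ax.
  have Amx := decreasing_leq dA (leq_maxl m n) Ax.
  have Anx := decreasing_leq dA (leq_maxr m n) Ax.
  by have [Bx|nBx] := pselect (B n x); [left|right].
have D0 k n : k < n -> (A n `\` B n) `&` leaves (w k) = set0.
  by move=> ltkn; rewrite -subset0 => x [[_ nBx] wx]; apply: nBx; exists k.
have dD n : A n.+1 `\` B n.+1 `<=` A n `\` B n.
  move=> x [/dA Ax nBx]; split=> // - [k ltk wx]; apply: nBx.
  by exists k => //; apply: leqW.
have /choice[Y YP] j : exists Y, null (fan w) Y /\
    forall n, ~ null (t j) (Y `&` (A n `\` B n)).
  by have [Y ? ?] := tree_diagonalizes iw mw (ltw j) dD (pD j) D0; exists Y.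
have /choice[q qP] j := proj1 (YP j).
exists [set x | exists j, (Y j `&` (A (maxn j (q j)) `\` B (maxn j (q j)))) x].
  apply: (null_glue (p := fun j => maxn j (q j)) D0) => j; first exact: leq_maxl.
  by move=> k; rewrite geq_max => /andP[_]; apply: qP.
(* From this index on, [Y j] meets the sequence inside the [j]-th glued piece and inside [A n]. *)
move=> j n nY; apply: (proj2 (YP j) (maxn n (maxn j (q j)))).
apply: null_sub nY => x [Yx Dx]; split.
  by exists j; split=> //; apply: (decreasing_leq dD) Dx; apply: leq_maxr.
by have [] := decreasing_leq dD (leq_maxl n _) Dx.
Qed.

(** * An increasing chain of contours of all countable ranks *)

Lemma ozero_le a : ole ozero a.
Proof. by case: a => I f []. Qed.

Fixpoint relabel (f : nat -> nat) (t : tree) : tree :=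
  match t with
  | leaf x => leaf (f x)
  | fan s => fan (fun n => relabel f (s n))
  end.

Lemma rk_relabel f t : rk (relabel f t) = rk t.
Proof. by elim: t => [|s IH] //=; congr osup; apply: funext. Qed.

Lemma leaves_relabel f t : leaves (relabel f t) = f @` leaves t.
Proof.
elim: t => [x|s IH] /=; first by rewrite image_set1.
rewrite predeqE => y; split=> [[n]|[x [n sx] <-]].
  by rewrite IH => -[x sx <-]; exists x => //; exists n.
by exists n; rewrite IH; exists x.
Qed.

Lemma tcontour_relabel f t A : tcontour (relabel f t) A = tcontour t (f @^-1` A).
Proof.
elim: t => [|s IH] //=; rewrite propeqE.
by split=> -[N sA]; exists N => n /sA; rewrite IH.
Qed.

Lemma mono_relabel f t : mono_rk t -> mono_rk (relabel f t).
Proof.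
elim: t => [|s IH] //= [ms le_s]; split=> [n|m n lemn]; first exact: IH.
by rewrite !rk_relabel; apply: le_s.
Qed.

Lemma inj_relabel f t : injective f -> inj_leaves t -> inj_leaves (relabel f t).
Proof.
move=> f_inj; elim: t => [|s IH] //= [is_ ds]; split=> [n|m n x]; first exact: IH.
rewrite !leaves_relabel => -[y sy <-] [z sz /f_inj eyz].
by apply: ds sy _; rewrite -eyz.
Qed.

(** The index where the maximum of [f 0], ..., [f n] is first attained: it makes a sequence of ranks
    non-decreasing, with the same strict supremum and using only its own terms. *)
Fixpoint runmax (f : nat -> Ord) (n : nat) : nat :=
  if n is m.+1 then
    if `[< olt (f (runmax f m)) (f n) >] then n else runmax f m
  else 0.

Lemma runmaxS f n : runmax f n.+1 = runmax f n \/
  runmax f n.+1 = n.+1 /\ olt (f (runmax f n)) (f n.+1).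
Proof. by rewrite /=; case: asboolP => ?; [right|left]. Qed.

Lemma runmax_leS f n : ole (f (runmax f n)) (f (runmax f n.+1)).
Proof.
have [->|[-> /olt_ole //]] := runmaxS f n; exact: ole_refl.
Qed.

Lemma runmax_homo f m n : m <= n -> ole (f (runmax f m)) (f (runmax f n)).
Proof.
elim: n => [|n IH]; first by rewrite leqn0 => /eqP->; apply: ole_refl.
rewrite leq_eqVlt => /predU1P[->|/IH]; first exact: ole_refl.
by move=> /ole_trans; apply; apply: runmax_leS.
Qed.

Lemma runmax_ge f n : ole (f n) (f (runmax f n)).
Proof.
case: n => [|n] /=; first exact: ole_refl.
case: asboolP => nlt; first exact: ole_refl.
by have [|/nlt] := ole_total (f n.+1) (f (runmax f n)).
Qed.

Definition slice (n x : nat) : nat := pickle (n, x).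

Lemma slice_inj n : injective (slice n).
Proof. by move=> x y /(pcan_inj pickleK)[]. Qed.

Lemma slice_disj m n x y : slice m x = slice n y -> m = n.
Proof. by move=> /(pcan_inj pickleK)[]. Qed.

(** Ranks start at 1, with the cofinite filter. In every tree built by [code_sup], the [n]-th branch
    lives on the same copy [slice n] of omega, so that contours can be compared branch by branch. *)
Fixpoint ctree (c : countable_code) : tree :=
  match c with
  | code_zero => fan leaf
  | code_sup s =>
      let f n := ctree (s n) in
      fan (fun n => relabel (slice n) (f (runmax (rk \o f) n)))
  end.

Lemma ctree_supE s : ctree (code_sup s) =
  fan (fun n => relabel (slice n) (ctree (s (runmax (fun m => rk (ctree (s m))) n)))).
Proof. by []. Qed.

Lemma rk_ctree_supE s : rk (ctree (code_sup s)) =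
  osup (fun n => rk (ctree (s (runmax (fun m => rk (ctree (s m))) n)))).
Proof.
by rewrite ctree_supE; congr osup; apply: funext => n; apply: rk_relabel.
Qed.

Lemma rk_ctree_sup s : oeq (rk (ctree (code_sup s))) (osup (fun n => rk (ctree (s n)))).
Proof.
rewrite rk_ctree_supE; split; apply: osup_least => n.
  by eexists; apply: ole_refl.
exists n; exact: (runmax_ge (fun m => rk (ctree (s m)))).
Qed.

Lemma rk_ctree_zero : oeq (rk (ctree code_zero)) oone.
Proof. by split=> /= _; [exists tt|exists 0] => -[]. Qed.

Lemma mono_ctree c : mono_rk (ctree c).
Proof.
elim: c => [|s IH] /=; first by split=> // m n _ [].
split=> [n|m n lemn]; first exact: mono_relabel.
by rewrite !rk_relabel; apply: (runmax_homo (fun m => rk (ctree (s m)))).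
Qed.

Lemma inj_ctree c : inj_leaves (ctree c).
Proof.
elim: c => [|s IH] /=; first by split=> // m n x /= -> ->.
split=> [n|m n x]; first by apply: inj_relabel; [apply: slice_inj|].
by rewrite !leaves_relabel => -[y _ <-] [z _ /esym /slice_disj].
Qed.

Lemma null1_fan s x : inj_leaves (fan s) -> null (fan s) [set x].
Proof.
move=> is_.
have [[k sx]|nsx] := pselect (exists k, leaves (s k) x).
  apply: null_sub (null_below is_ k.+1) => _ ->.
  by exists k.
by apply: null_disj; rewrite -subset0 => _ [-> [k sx]]; apply: nsx; exists k.
Qed.

Lemma rk_ctree_ge1 c : ole oone (rk (ctree c)).
Proof. by apply: osup_least => _; case: c => [|s]; exists 0; apply: ozero_le. Qed.

(** From some index on, the branches of [d] have at least the rank of the whole of [c], hence more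
    than each branch of [c]; the induction compares branches on the same slice. For [code_zero],
    finite sets are null in every [ctree]. *)
Lemma ctree_chain c d : olt (rk (ctree c)) (rk (ctree d)) ->
  tcontour (ctree c) `<=` tcontour (ctree d).
Proof.
elim: c d => [|s IH] [|s'] lt_cd; try
  by have := ole_olt_trans (rk_ctree_ge1 _)
               (olt_ole_trans lt_cd (proj1 rk_ctree_zero)); move/olt_irrefl.
  move=> A [N AN].
  have nn : null (ctree (code_sup s')) [set x | exists2 i, i < N & x = i].
    by apply: null_fin => i _; apply: null1_fan; exact: (inj_ctree (code_sup s')).
  apply: tcontourS nn => x nx; apply: AN; rewrite leqNgt; apply/negP => ltxN.
  by apply: nx; exists x.
rewrite !ctree_supE => A [N AN].
move: lt_cd; rewrite (rk_ctree_supE s') => /olt_osup[N' le_cN'].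
exists (maxn N N') => n; rewrite geq_max => /andP[/AN sA leN'n].
have {sA} := sA : tcontour (relabel _ _) A; rewrite !tcontour_relabel.
set i := runmax _ n; set j := runmax _ n.
suff lt_ij : olt (rk (ctree (s i))) (rk (ctree (s' j))) by apply: (IH i _ lt_ij).
apply: (@olt_ole_trans (rk (ctree (code_sup s)))).
  by rewrite rk_ctree_supE; exists n; apply: ole_refl.
apply: ole_trans le_cN' _.
exact: (runmax_homo (fun m => rk (ctree (s' m)))).
Qed.

Lemma countable_ole a b : ole a b -> countable_ordinal b -> countable_ordinal a.
Proof. by rewrite !omega1P; apply: ole_olt_trans. Qed.

Lemma countable_codes (b : Ord) : countable_ordinal b -> olt oone b ->
  (forall a, ole oone a -> olt a b -> exists c, oeq (rk (ctree c)) a) ->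
  exists s : nat -> countable_code, (forall n, olt (rk (ctree (s n))) b) /\
    (forall a, ole oone a -> olt a b -> exists n, oeq (rk (ctree (s n))) a).
Proof.
move=> [e eP] lt1b codes.
have /choice[s sP] n : exists c, olt (rk (ctree c)) b /\
    (ole oone (e n) -> olt (e n) b -> oeq (rk (ctree c)) (e n)).
  have [[le1 ltb]|nn] := pselect (ole oone (e n) /\ olt (e n) b).
    have [c ec] := codes _ le1 ltb; exists c; split=> //.
    by apply: ole_olt_trans ltb; case: ec.
  (* The default has rank 1, which is smaller than [b]. *)
  exists code_zero; split=> [|? ?]; last by case: nn.
  exact: ole_olt_trans (proj1 rk_ctree_zero) lt1b.
exists s; split=> [n|a le1a ltab]; first by case: (sP n).
have [n [le_a ge_a]] := eP _ ltab; exists n.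
have [_ [||le_c ge_c]] := sP n.
- exact: ole_trans le_a.
- exact: ole_olt_trans ltab.
by split; [apply: ole_trans ge_a|apply: ole_trans ge_c].
Qed.

(** By induction, a sequence of codes realizes all ranks from 1 up to [b]. If its [code_sup] had
    rank smaller than [b], that rank would itself be in the sequence. *)
Lemma ctree_rank_ex b : countable_ordinal b -> ole oone b ->
  exists c, oeq (rk (ctree c)) b.
Proof.
elim/(well_founded_induction olt_wf): b => b IH cb le1b.
have [leb1|lt1b] := ole_total b oone.
  exists code_zero; have [le1 ge1] := rk_ctree_zero.
  by split; [apply: ole_trans le1b|apply: ole_trans ge1].
have [|s [ltb sP]] := countable_codes cb lt1b.
  by move=> a le1a ltab; apply: IH => //; apply: countable_ole cb; apply: olt_ole.
exists (code_sup s); have [le_s ge_s] := rk_ctree_sup s.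
have leb : ole (rk (ctree (code_sup s))) b.
  by apply: ole_trans le_s _; apply: osup_least.
split=> //; have [//|lt_b] := ole_total b (rk (ctree (code_sup s))).
have [n [_ ge_n]] := sP _ (rk_ctree_ge1 _) lt_b.
have /olt_irrefl[] : olt (rk (ctree (s n))) (rk (ctree (s n))).
by apply: olt_ole_trans ge_n; apply: olt_ole_trans ge_s; apply: osup_gt.
Qed.

(** The [t j] follow a running maximum of ranks, which may skip [b]; hence the separate tree [t'] in
    the last clause. *)
Lemma increasing_contours a : countable_ordinal a -> ole oone a ->
  exists t : nat -> tree,
  [/\ forall j, tcontour (t j) `<=` tcontour (t j.+1),
      forall j, olt (rk (t j)) a &
      forall b, ole oone b -> olt b a -> exists j t',
        [/\ inj_leaves t', mono_rk t', oeq (rk t') b &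
            tcontour t' `<=` tcontour (t j)]].
Proof.
move=> ca le1a; have [lea1|lt1a] := ole_total a oone.
  (* Here [a] is 1: a principal ultrafilter will do. *)
  exists (fun=> leaf 0); split=> [j|j|b le1b ltba]; first by [].
    exact: (olt_ole_trans (osup_gt (fun=> ozero) tt) le1a).
  by case: (@olt_irrefl b); apply: olt_ole_trans ltba (ole_trans lea1 le1b).
have [|s [lta sP]] := countable_codes ca lt1a.
  move=> b le1b ltba; apply: ctree_rank_ex => //.
  by apply: countable_ole ca; apply: olt_ole.
pose f n := rk (ctree (s n)).
exists (fun j => ctree (s (runmax f j))); split=> [j|j|b le1b ltba].
- by have [->//|[E lt_f]] := runmaxS f j; rewrite E; apply: ctree_chain.
- exact: lta.
have [n [le_b ge_b]] := sP _ le1b ltba; exists n.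
(* [ctree_chain] asks for a strict inequality; at equal ranks the running maximum itself serves as
   [t']. *)
have [le_f|lt_f] := ole_total (f (runmax f n)) (f n).
  exists (ctree (s (runmax f n))); split=> //.
  - exact: inj_ctree.
  - exact: mono_ctree.
  - by split; [apply: ole_trans le_b|apply: ole_trans (runmax_ge f n)].
exists (ctree (s n)); split=> //.
- exact: inj_ctree.
- exact: mono_ctree.
- exact: ctree_chain.
Qed.

(** * Cascades and trees *)

Section CascadeTree.
Variable V : cascade.
Implicit Types (r : V -> Ord) (l : V -> nat).

Lemma oeq_sym a b : oeq a b -> oeq b a.
Proof. by case. Qed.

Lemma oeq_trans b a c : oeq a b -> oeq b c -> oeq a c.
Proof.
by move=> [ab ba] [bc cb]; split; [apply: ole_trans bc|apply: ole_trans ba].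
Qed.

Lemma below_refl (v : V) : below v v.
Proof. by case: (below_order V). Qed.

Lemma below_trans (v u w : V) : below u v -> below v w -> below u w.
Proof. by case: (below_order V) => _ tr _; apply: tr. Qed.

(** Identifies the rank functions that [monotone] and [has_rank] provide separately. *)
Lemma is_rank_unique r r' : is_rank r -> is_rank r' -> forall v, oeq (r v) (r' v).
Proof.
move=> rr rr' v; have [a ra] : exists a, r v = a by exists (r v).
elim/(well_founded_ind olt_wf): a v ra => a IH v ra.
have [[rmax rsucc] [rmax' rsucc']] := (rr v, rr' v).
have [mv|nmv] := pselect (maximal_nodes v).
  by apply: oeq_trans (rmax mv) _; apply: oeq_sym; apply: rmax'.
have [[gt least] [gt' least']] := (rsucc nmv, rsucc' nmv).
have E w : successors v w -> oeq (r w) (r' w).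
  by move=> /gt; rewrite ra => rw; apply: (IH (r w)).
split; [apply: least => w vw|apply: least' => w vw]; have [le1 le2] := E w vw.
  by apply: ole_olt_trans le1 _; apply: gt'.
by apply: ole_olt_trans le2 _; apply: gt.
Qed.

Lemma successors_incomparable (v w w' : V) : successors v w -> successors v w' ->
  below w w' -> w = w'.
Proof.
move=> [vw _] [_ nvw'] ww'; apply: contrapT => neq; apply: nvw'; by exists w.
Qed.

Lemma below_comparable (u w w' : V) : below w u -> below w' u ->
  below w w' \/ below w' w.
Proof.
move=> wu w'u; have [||m [->|->] mP] := @below_tree V u [set w; w'].
- by move=> x [->|->].
- by exists w; left.
- by left; apply: mP; right.
- by right; apply: mP; left.
Qed.

(** Induction on [r v], along the monotone enumeration of the successors. One inclusion suffices: a
    filter that does not contain [tcontour t] does not contain the larger contour either. *)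
Lemma tree_of_node l r : is_rank r ->
  (forall v : V, ~ maximal_nodes v ->
    exists2 e : nat -> V, set_bij [set: nat] (successors v) e &
      forall m n : nat, m <= n -> ole (r (e m)) (r (e n))) ->
  {in @maximal_nodes V &, injective l} ->
  forall v, exists t,
    [/\ inj_leaves t, mono_rk t, oeq (rk t) (r v),
        leaves t `<=` max_above l v & tcontour t `<=` contour_at l v].
Proof.
move=> rr mr l_inj v; have [a ra] : exists a, r v = a by exists (r v).
elim/(well_founded_ind olt_wf): a v ra => a IH v ra.
have [rmax rsucc] := rr v.
have [mv|nmv] := pselect (maximal_nodes v).
  exists (leaf (l v)); split=> //.
  - by apply: oeq_sym; apply: rmax.
  - by move=> _ ->; exists v => //; split=> //; apply: below_refl.
  - by move=> A Av; apply: contour_maximal.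
have [gt least] := rsucc nmv.
have [e [e_fun e_inj e_surj] e_mono] := mr _ nmv.
have vsucc n : successors v (e n) by apply: e_fun.
have /choice[s sP] n := IH (r (e n)) (eq_ind _ _ (gt _ (vsucc n)) _ ra) _ erefl.
exists (fan s); split=> /=.
- split=> [n|m n x]; first by have [] := sP n.
  have [_ _ _ sm _] := sP m; have [_ _ _ sn _] := sP n.
  move=> /sm[u [mu mu'] <-] /sn[u' [nu nu']] /l_inj Euu.
  have {}Euu : u' = u by apply: Euu; apply: mem_set.
  apply: e_inj; try exact: mem_set.
  rewrite Euu in nu'.
  (* Two successors below the same maximal node are comparable, hence equal. *)
  by have [/successors_incomparable|/successors_incomparable/esym] :=
    below_comparable mu' nu'; apply; apply: vsucc.
- split=> [n|m n lemn]; first by have [] := sP n.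
  have [_ _ [lem _] _ _] := sP m; have [_ _ [_ gen] _ _] := sP n.
  by apply: ole_trans lem (ole_trans (e_mono _ _ lemn) gen).
- split; last first.
    apply: least => w vw; have [n _ <-] := e_surj _ vw.
    have [_ _ [_ gen] _ _] := sP n.
    by apply: ole_olt_trans gen _; apply: (osup_gt (fun n => rk (s n))).
  apply: osup_least => n; have [_ _ [len _] _ _] := sP n.
  by apply: ole_olt_trans len _; apply: gt.
- move=> x [n]; have [_ _ _ sn _] := sP n => /sn[u [mu nu] <-].
  exists u => //; split=> //; apply: below_trans nu.
  by have [[]] := vsucc n.
- move=> A [N AN]; apply: (@contour_node _ _ _ _ (e @` `I_N)) => //.
    exact/finite_image/finite_II.
  move=> w vw nEw; have [n _ En] := e_surj _ vw; rewrite -En.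
  have [_ _ _ sn] := sP n; apply.
  apply: tcontourI; last by apply: tcontourS (tcontour_leaves _).
  by apply: AN; rewrite leqNgt; apply/negP => ltnN; apply: nEw; exists n.
Qed.

End CascadeTree.

Lemma tree_of_contour a F : is_monotone_sequential_contour a F ->
  exists t, [/\ inj_leaves t, mono_rk t, oeq (rk t) a & tcontour t `<=` F].
Proof.
move=> [V [l [_ [r rr mr] [r' rr' r'a] l_inj ->]]].
have [t [it mt rt _ ct]] := tree_of_node rr mr l_inj (least_node V).
exists t; split=> //; apply: oeq_trans rt _; apply: oeq_trans r'a.
exact: is_rank_unique.
Qed.

(** * Trees as cascades of index paths *)

Fixpoint subtree (t : tree) (p : seq nat) {struct p} : option tree :=
  match p, t with
  | [::], _ => Some t
  | n :: q, fan s => subtree (s n) q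
  | _ :: _, leaf _ => None
  end.

Lemma subtree_cat t p q :
  subtree t (p ++ q) = obind (subtree^~ q) (subtree t p).
Proof. by elim: p t => [|n p IH] [x|s] //=; rewrite IH. Qed.

Lemma subtree_leaf t p x : subtree t p = Some (leaf x) -> leaves t x.
Proof.
elim: t p => [y|s IH] [|n p] //=; first by move=> [->].
by move=> /IH; exists n.
Qed.

Lemma subtree_leaf_inj t p q x : inj_leaves t ->
  subtree t p = Some (leaf x) -> subtree t q = Some (leaf x) -> p = q.
Proof.
elim: t p q => [y|s IH] [|m p] [|n q] //= [is_ ds] sp sq.
have E := ds _ _ _ (subtree_leaf sp) (subtree_leaf sq).
by move: sp; rewrite E => sp; congr cons; apply: IH sp sq.
Qed.

Lemma subtree_mono t p : mono_rk t ->
  forall u, subtree t p = Some u -> mono_rk u.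
Proof.
elim: p t => [|n p IH] t mt u; first by case=> <-.
by case: t mt => //= s [ms _]; apply: IH.
Qed.

(** All nonempty paths of a chain start with the same index; dropping it leaves a chain in one
    branch. *)
Lemma finite_chain t (C : set (seq nat)) :
  (forall p, C p -> subtree t p) ->
  (forall p q, C p -> C q -> prefix p q \/ prefix q p) -> finite_set C.
Proof.
elim: t C => [x|s IH] C Ct Cp.
  by apply: sub_finite_set (finite_set1 [::]) => -[|n p /Ct].
have [[n [p Cnp]]|nC] := pselect (exists n p, C (n :: p)); last first.
  apply: sub_finite_set (finite_set1 [::]) => -[//|n p Cnp].
  by case: nC; exists n, p.
apply: (@sub_finite_set _ _ ([set [::]] `|` cons n @` [set q | C (n :: q)])).
  move=> [|m q Cmq]; first by left.
  right; have E : m = n.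
    by have [] := Cp _ _ Cnp Cmq; rewrite prefix_cons => /andP[/eqP->].
  by exists q; rewrite -E.
rewrite finite_setU; split; first exact: finite_set1.
apply: finite_image; apply: (IH n) => [p0 /Ct //|p0 q0 Cp0 Cq0].
by have := Cp _ _ Cp0 Cq0; rewrite !prefix_cons !eqxx.
Qed.

Lemma prefix_antisym (p q : seq nat) : prefix p q -> prefix q p -> p = q.
Proof.
move=> pq qp; move: pq; rewrite prefixE => /eqP<-.
by rewrite take_oversize // size_prefix.
Qed.

Lemma prefix_total (p q u : seq nat) : prefix p u -> prefix q u ->
  size p <= size q -> prefix p q.
Proof.
move=> pu /prefixP[q' Eu] le_pq; move: pu.
by rewrite Eu !prefixE takel_cat.
Qed.

Section TreeCascade.
Variable t : tree.

Definition path_below (p q : {p : seq nat | subtree t p}) : Prop :=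
  prefix (val p) (val q).

Lemma path_below_order : Relation_Definitions.order _ path_below.
Proof.
split=> [p|q p u|p q pq qp]; first exact: prefix_refl.
  exact: prefix_trans.
exact/val_inj/prefix_antisym.
Qed.

Lemma path_below_tree v (A : set {p : seq nat | subtree t p}) :
  A `<=` [set w | path_below w v] -> A !=set0 ->
  exists2 m, A m & forall w, A w -> path_below m w.
Proof.
move=> Av [a Aa].
have exA : exists n, `[< exists2 u, A u & size (val u) = n >].
  by exists (size (val a)); apply/asboolP; exists a.
case: (ex_minnP exA) => _ /asboolP[m Am <-] min_m; exists m => // w Aw.
apply: prefix_total (Av _ Am) (Av _ Aw) _.
by apply: min_m; apply/asboolP; exists w.
Qed.

Definition path_root : {p : seq nat | subtree t p} := exist _ [::] isT.

Lemma path_root_least v : path_below path_root v.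
Proof. exact: prefix0s. Qed.

Lemma path_branch_finite B : is_branch path_below B -> finite_set B.
Proof.
move=> [totB _].
have finB : finite_set (val @` B).
  apply: (@finite_chain t) => [_ [p _ <-]|_ _ [p Bp <-] [q Bq <-]].
    exact: (valP p).
  exact: totB.
apply: sub_finite_set (finite_preimage _ finB) => [p Bp|]; first by exists p.
by move=> p q _ _ /val_inj.
Qed.

Definition path_cascade : cascade :=
  Cascade path_below_order path_below_tree path_root_least path_branch_finite.

Implicit Type p q w : path_cascade.

Definition tree_at p : tree := odflt (leaf 0) (subtree t (val p)).

Lemma subtree_at p : subtree t (val p) = Some (tree_at p).
Proof. by rewrite /tree_at; case: (subtree t (val p)) (valP p). Qed.

Lemma subtree_at_cat p (q : seq nat) : subtree t (val p ++ q) = subtree (tree_at p) q.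
Proof. by rewrite subtree_cat subtree_at. Qed.

(** The default [p] of [insubd] is returned exactly when [tree_at p] is a leaf. *)
Definition child p (n : nat) : path_cascade := insubd p (rcons (val p) n).

Section Fan.
Variables (p : path_cascade) (s : nat -> tree).
Hypothesis ps : tree_at p = fan s.

Lemma val_child n : val (child p n) = rcons (val p) n.
Proof.
by apply: insubdK; rewrite /in_mem /= -cats1 subtree_at_cat ps.
Qed.

Lemma tree_at_child n : tree_at (child p n) = s n.
Proof.
by apply: Some_inj; rewrite -subtree_at val_child -cats1 subtree_at_cat ps.
Qed.

Lemma child_inj : injective (child p).
Proof.
by move=> m n /(congr1 val); rewrite !val_child => /rcons_inj[].
Qed.

Lemma below_child n : strictly_below p (child p n).
Proof.
split; first by rewrite /= /path_below val_child prefix_rcons.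
move=> /(congr1 (size \o val)); rewrite /= val_child size_rcons => /eqP.
by rewrite eqn_leq ltnn andbF.
Qed.

Lemma fan_not_maximal : ~ maximal_nodes p.
Proof. by have [b ne] := below_child 0 => /(_ _ b) /esym. Qed.

Lemma successors_child : successors p = range (child p).
Proof.
rewrite predeqE => w; split=> [[[pw nepw] between]|[n _ <-]].
  have /prefixP[[|n q] Ew] := pw.
    by case: nepw; apply: val_inj; rewrite Ew cats0.
  exists n => //; apply: contrapT => ne; apply: between; exists (child p n).
  split; first exact: below_child.
  by split=> //=; rewrite /path_below val_child Ew -cat_rcons prefix_prefix.
split; first exact: below_child.
move=> [u [[pu nepu] [uc neuc]]].
have strict (x y : path_cascade) : below x y -> x <> y -> size (val x) < size (val y).
  move=> xy nexy; rewrite ltnNge; apply/negP => le_yx; apply: nexy.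
  apply/val_inj/prefix_antisym => //.
  exact: prefix_total (prefix_refl _) xy le_yx.
have := strict _ _ uc neuc; rewrite val_child size_rcons ltnS => le_up.
by have := leq_trans (strict _ _ pu nepu) le_up; rewrite ltnn.
Qed.

End Fan.

Lemma leaf_maximal p x : tree_at p = leaf x -> maximal_nodes p.
Proof.
move=> px w /prefixP[q Ew]; apply: val_inj.
have : subtree t (val w) by exact: (valP w).
by rewrite Ew subtree_at_cat px; case: q {Ew} => // _; rewrite cats0.
Qed.

Lemma maximal_leaf p : maximal_nodes p -> exists x, tree_at p = leaf x.
Proof.
by case E: (tree_at p) => [x|s]; [exists x|move/(fan_not_maximal E)].
Qed.

Lemma not_maximal_fan p : ~ maximal_nodes p -> exists s, tree_at p = fan s.
Proof.
by case E: (tree_at p) => [x|s]; [move=> []; apply: leaf_maximal E|exists s].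
Qed.

Lemma child_bij p s : tree_at p = fan s ->
  set_bij [set: nat] (successors p) (child p).
Proof.
move=> ps; rewrite (successors_child ps); split => //.
  by move=> m n _ _; apply: child_inj ps _ _.
Qed.

Definition label p : nat := if tree_at p is leaf x then x else 0.

Lemma path_sequential : sequential path_cascade.
Proof.
move=> p /not_maximal_fan[s ps]; rewrite (successors_child ps).
by apply: inj_card_eq => m n _ _; apply: child_inj ps _ _.
Qed.

Lemma path_is_rank : is_rank (fun p => rk (tree_at p)).
Proof.
move=> p; split=> [/maximal_leaf[x ->]|/not_maximal_fan[s ps]].
  by split; apply: ole_refl.
rewrite (successors_child ps) ps; split=> [_ [n _ <-]|b ltb].
  by rewrite (tree_at_child ps); apply: (osup_gt (fun n => rk (s n))).
apply: osup_least => n; rewrite -(tree_at_child ps).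
by apply: ltb; exists n.
Qed.

Lemma tree_at_mono p : mono_rk t -> mono_rk (tree_at p).
Proof. by move=> mt; apply: subtree_mono mt _ (subtree_at p). Qed.

Lemma path_monotone : mono_rk t -> monotone path_cascade.
Proof.
move=> mt; exists (fun p => rk (tree_at p)); first exact: path_is_rank.
move=> p /not_maximal_fan[s ps]; exists (child p); first exact: child_bij ps.
move=> m n lemn; rewrite !(tree_at_child ps).
by have := tree_at_mono p mt; rewrite ps => -[_]; apply.
Qed.

Lemma path_has_rank : has_rank path_cascade (rk t).
Proof.
exists (fun p => rk (tree_at p)); first exact: path_is_rank.
by split; apply: ole_refl.
Qed.

Lemma label_inj : inj_leaves t -> {in @maximal_nodes path_cascade &, injective label}.
Proof.
move=> it p q /set_mem/maximal_leaf[x px] /set_mem/maximal_leaf[y qy].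
rewrite /label px qy => Exy; apply/val_inj.
apply: (subtree_leaf_inj it (x := x)); rewrite subtree_at ?px //.
by rewrite qy Exy.
Qed.

(** The inclusion opposite to that of [tree_of_node]: it lets a filter above [tcontour t] contain a
    genuine contour. Finitely many exceptional children have bounded indices. *)
Lemma contour_at_path p A : contour_at label p A -> tcontour (tree_at p) A.
Proof.
elim=> {p A} [p A /maximal_leaf[x px]|p A E /not_maximal_fan[s ps] finE _ IH].
  by rewrite /label px.
rewrite ps.
have finI : finite_set (child p @^-1` E).
  by apply: finite_preimage => // m n _ _; apply: child_inj ps _ _.
have [N NE] : exists N, forall n, N <= n -> ~ E (child p n).
  have /finite_seqP[u Eu] := finI.
  exists (\max_(i <- u) i).+1 => n lt_n En.
  have nu : n \in u by have : (child p @^-1` E) n by []; rewrite Eu.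
  by move: lt_n; rewrite ltnNge (leq_bigmax_seq n).
exists N => n leNn; rewrite -(tree_at_child ps).
apply: tcontourS (IH (child p n) _ (NE _ leNn)) => [x []//|].
by rewrite (successors_child ps); exists n.
Qed.

End TreeCascade.

Lemma contour_of_tree t a : inj_leaves t -> mono_rk t -> oeq (rk t) a ->
  exists2 F, is_monotone_sequential_contour a F & F `<=` tcontour t.
Proof.
move=> it mt ra; exists (contour (@label t)).
  exists (path_cascade t), (@label t); split=> //.
  - exact: path_sequential.
  - exact: path_monotone.
  - have [r rr r_t] := path_has_rank t.
    by exists r => //; apply: oeq_trans ra.
  - exact: label_inj.
by move=> A; apply: contour_at_path.
Qed.

(** * Transfinite construction of an ultrafilter *)

Definition strict_well_order (T : Type) (lt : T -> T -> Prop) : Prop :=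
  [/\ well_founded lt, forall x y z, lt x y -> lt y z -> lt x z &
      forall x y, [\/ lt x y, x = y | lt y x]].

Lemma strict_well_order_ex (T : eqType) :
  exists lt : T -> T -> Prop, strict_well_order lt.
Proof.
have [R Rwo] := wochoice.well_ordering_principle T.
have Rch : wochoice.wo_chain R predT by move=> A _; apply: Rwo.
have Rtot x y : R x y \/ R y x.
  by apply/orP; apply: (wochoice.wo_chainW Rch).
have Ranti x y : R x y -> R y x -> x = y.
  by move=> xy yx; apply: (wochoice.wo_chain_antisymmetric Rch); rewrite ?xy.
have Rtr y x z : R x y -> R y z -> R x z.
  (* Transitivity is read off the least of the three points. *)
  move=> xy yz; have [|m [[+ lbm] _]] := Rwo [mem [:: x; y; z]].
    by exists x; rewrite !inE eqxx.
  have Rm u : u \in [:: x; y; z] -> R m u by apply: lbm.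
  have [mx my mz] : [/\ R m x, R m y & R m z].
    by split; apply: Rm; rewrite !inE eqxx ?orbT.
  rewrite !inE => /or3P[] /eqP E; rewrite E in mx my mz => //.
    by rewrite (Ranti _ _ xy mx).
  by rewrite -(Ranti _ _ yz my).
exists (fun x y => R x y /\ x <> y); split=> [x|x y z [xy nxy] [yz nyz]|x y].
- apply: contrapT => nacc.
  have [|m [[nm lbm] _]] := Rwo [pred y | ~~ `[< Acc (fun x y => R x y /\ x <> y) y >]].
    by exists x; apply/negP => /asboolP.
  move: nm => /negP; apply; apply/asboolP; constructor=> y [ym neq].
  apply: contrapT => naccy; apply: neq; apply: Ranti ym _.
  by apply: lbm; apply/negP => /asboolP.
- split; first exact: Rtr yz.
  by move=> E; apply: nyz; apply: Ranti yz _; rewrite -E.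
- have [->|ne] := pselect (x = y); first by constructor 2.
  by have [xy|yx] := Rtot x y; [constructor 1|constructor 3; split=> // /esym].
Qed.

Lemma strict_well_order_inj (T U : Type) (f : T -> U) (lt : U -> U -> Prop) :
  injective f -> strict_well_order lt ->
  strict_well_order (fun x y => lt (f x) (f y)).
Proof.
move=> f_inj [wf tr tri]; split=> [x|x y z|x y]; last 2 first.
- exact: tr.
- have [?|/f_inj ->|?] := tri (f x) (f y);
  by [constructor 1|constructor 2|constructor 3].
have [u fx] : exists u, f x = u by exists (f x).
elim/(well_founded_ind wf): u x fx => u IH x fx; constructor=> y ltyx.
by apply: (IH (f y)) => //; rewrite -fx.
Qed.

(* Some well-order of the reals, cut at the first point whose initial segment is
   uncountable and then transported along a bijection given by CH. *)
Lemma ch_well_order : continuum_hypothesis ->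
  exists2 lt : set nat -> set nat -> Prop, strict_well_order lt &
    forall x, countable [set y | lt y x].
Proof.
move=> ch; have [lt lt_wo] := strict_well_order_ex (set nat).
have [wf tr tri] := lt_wo.
have [cnt|ncnt] := pselect (forall x, countable [set y | lt y x]); first by exists lt.
have [x nx minx] : exists2 x, ~ countable [set y | lt y x] &
    forall y, lt y x -> countable [set z | lt z y].
  apply: contrapT => nmin; apply: ncnt => x.
  elim/(well_founded_ind wf): x => x IH; apply: contrapT => nx.
  by apply: nmin; exists x.
have [//|] := ch [set y | lt y x].
rewrite card_eq_sym => /card_set_bijP[g [g_fun g_inj _]].
have {}g_inj : injective g by move=> y z; apply: g_inj; apply: mem_set.
exists (fun y z => lt (g y) (g z)); first exact: strict_well_order_inj lt_wo.
move=> y; have /countable_injP[f f_inj] := minx _ (g_fun y I).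
apply/countable_injP; exists (f \o g) => z z' /set_mem zy /set_mem z'y fE.
by apply/g_inj/f_inj => //; apply: mem_set.
Qed.

(** Recursion with choice, for a [P t] that reads a function only below [t]. The conclusion is
    conditional because a value may exist only if the earlier choices were good. *)
Lemma well_founded_choice (T B : Type) (lt : T -> T -> Prop)
    (P : T -> (T -> B) -> B -> Prop) (b0 : B) : well_founded lt ->
  (forall t f g b, (forall u, lt u t -> f u = g u) -> P t f b -> P t g b) ->
  exists K : T -> B, forall t, (exists b, P t K b) -> P t K (K t).
Proof.
move=> wf Pext.
(* [b0] pads a function that is defined only below [t]. *)
pose ext t (rec : forall u, lt u t -> B) u :=
  if pselect (lt u t) is left h then rec u h else b0.
have /choice[c cP] (p : T * (T -> B)) : exists b, (exists b', P p.1 p.2 b') -> P p.1 p.2 b.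
  have [[b Pb]|nP] := pselect (exists b', P p.1 p.2 b'); first by exists b.
  by exists b0 => /nP.
pose body t rec := c (t, ext t rec).
exists (Fix wf (fun=> B) body) => t [b Pb].
set K := Fix wf (fun=> B) body in Pb *.
have KE : K t = c (t, ext t (fun u _ => K u)).
  rewrite /K Fix_eq // => u f g fg; congr (body _ _).
  by apply: functional_extensionality_dep => v; apply: functional_extensionality_dep => h.
have extE u : lt u t -> K u = ext t (fun u _ => K u) u.
  by rewrite /ext; case: pselect.
rewrite KE; apply: (Pext _ (ext t (fun u _ => K u))) => [u /extE //|].
by apply: (cP (t, _)); exists b; apply: Pext Pb => u /extE.
Qed.

Section Tower.
Variables (T : eqType) (lt : T -> T -> Prop) (F : set_system nat).
Variable D : T -> set nat -> Prop.
Hypothesis lt_wo : strict_well_order lt.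
Hypothesis lt_countable : forall t, countable [set u | lt u t].
Hypothesis F_proper : ProperFilter F.
Hypothesis F_step : forall A : nat -> set nat,
  (forall n, A n.+1 `<=` A n) -> (forall n, ~ F (~` A n)) ->
  forall t, exists2 Y, D t Y & forall n, ~ F (~` (Y `&` A n)).

Definition meet_of (K : T -> set nat) (L : seq T) : set nat :=
  [set x | forall u, u \in L -> K u x].

(** Finite lists of earlier points are enough to keep the filter generated by [F] and all [K u]
    proper. *)
Definition tower_step t (K : T -> set nat) (Y : set nat) : Prop :=
  D t Y /\ forall L : seq T, (forall u, u \in L -> lt u t) ->
    ~ F (~` (Y `&` meet_of K L)).

Lemma seq_maximum (L : seq T) : L <> [::] ->
  exists2 m, m \in L & forall u, u \in L -> u <> m -> lt u m.
Proof.
have [_ tr tri] := lt_wo.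
elim: L => // a L IH _; have [->|/eqP/IH[m mL mP]] := eqVneq L [::].
  by exists a; rewrite ?inE // => u; rewrite inE => /eqP.
have [am|am|ma] := tri a m.
- exists m; first by rewrite inE mL orbT.
  by move=> u; rewrite inE => /predU1P[->//|/mP].
- exists m; first by rewrite inE mL orbT.
  by move=> u; rewrite inE => /predU1P[->//|/mP].
- exists a; first exact: mem_head.
  move=> u; rewrite inE => /predU1P[-> //|uL _].
  by have [->//|um] := pselect (u = m); apply: tr ma; apply: mP.
Qed.

(** The claim is [tower_step] at the last point of [L], applied to the other points. *)
Lemma tower_meet K L : (forall u, u \in L -> tower_step u K (K u)) ->
  ~ F (~` meet_of K L).
Proof.
have [->|/eqP/seq_maximum[m mL mP]] := eqVneq L [::].
  move=> _; have -> : meet_of K [::] = setT by rewrite predeqE.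
  by rewrite setCT; apply: filter_not_empty.
move=> stepL nF; have [_ /(_ (seq.filter (predC1 m) L))] := stepL m mL; apply.
  by move=> u; rewrite mem_filter => /andP[/= /eqP um uL]; apply: mP.
apply: filterS nF; apply: subsetC => x [Kx Lx] u uL.
have [->//|um] := eqVneq u m.
by apply: Lx; rewrite mem_filter /= um.
Qed.

Lemma tower_step_ex t K : (forall u, lt u t -> tower_step u K (K u)) ->
  exists Y, tower_step t K Y.
Proof.
move=> stepK; have /countable_injP[f f_inj] := lt_countable t.
(* With the earlier points numbered by [f], every finite intersection of earlier sets contains some
   [A n]. *)
pose A n := [set x | forall u, lt u t -> f u < n -> K u x].
have listA n : exists L : seq T, forall u, u \in L <-> lt u t /\ f u < n.
  elim: n => [|n [L LP]]; first by exists [::] => u; split=> [|[]].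
  have [[v vt fv]|nv] := pselect (exists2 v, lt v t & f v = n).
    exists (v :: L) => u; rewrite inE; split.
      by move=> /predU1P[->|/LP[ut fu]]; rewrite ?fv ?leqnn //; split=> //; apply: ltnW.
    rewrite ltnS leq_eqVlt => -[ut /predU1P[fu|fu]]; apply/predU1P.
      by left; apply: f_inj; rewrite ?fv //; apply: mem_set.
    by right; apply/LP.
  exists L => u; rewrite LP; split=> -[ut fu]; split=> //; first exact: ltnW.
  move: fu; rewrite ltnS leq_eqVlt => /predU1P[fu|//].
  by case: nv; exists u.
have [n x Ax u ut fu|n nF|Y DY Ypos] := @F_step A _ _ t.
- by apply: Ax => //; apply: ltnW.
- have [L LP] := listA n; apply: (@tower_meet K L) => [u /LP[ut _]|]; first exact: stepK.
  apply: filterS nF; apply: subsetC => x Lx u ut fu.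
  by apply: Lx; apply/LP.
exists Y; split=> // L Lt nF; apply: (Ypos (\max_(u <- L) f u).+1).
apply: filterS nF; apply: subsetC => x [Yx Ax]; split=> // u uL.
by apply: Ax; [exact: Lt|rewrite ltnS leq_bigmax_seq].
Qed.

Lemma tower_ultrafilter : exists U : set_system nat,
  [/\ UltraFilter U, F `<=` U & forall t, exists2 Y, D t Y & U Y].
Proof.
have [wf _ _] := lt_wo.
have [t f g Y fg [DY fY]|K KP] := @well_founded_choice T (set nat) lt tower_step setT wf.
  split=> // L Lt nF; apply: (fY L Lt); apply: filterS nF; apply: subsetC.
  by move=> x [Yx fx]; split=> // u uL; rewrite -(fg u (Lt u uL)); apply: fx.
have {}KP t : tower_step t K (K t).
  by elim/(well_founded_ind wf): t => t IH; apply/KP/tower_step_ex.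
(* [G] is the filter generated by [F] and the sets [K u]. *)
pose G A := exists L : seq T, F [set x | meet_of K L x -> A x].
have GP : ProperFilter G.
  split=> [[L FL]|]; first by apply: (@tower_meet K L).
  split.
  - by exists [::]; apply: filterS filterT => x _ _.
  - move=> A B [L FA] [M FB]; exists (L ++ M); apply: filterS (filterI FA FB).
    move=> x [LA MB] LMx; split.
      by apply: LA => u uL; apply: LMx; rewrite mem_cat uL.
    by apply: MB => u uM; apply: LMx; rewrite mem_cat uM orbT.
  - move=> A B AB [L FA]; exists L; apply: filterS FA => x LA Lx.
    exact/AB/LA.
have [U [UU GU]] := ultraFilterLemma GP.
exists U; split=> // [A FA|t].
  by apply: GU; exists [::]; apply: filterS FA => x Ax _.
exists (K t); first by case: (KP t).
apply: GU; exists [:: t]; apply: filterS filterT => x _; apply.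
exact: mem_head.
Qed.

End Tower.

(** * Nonemptiness of the classes *)

(** Leaf paths with their labels determine the tree, so sets of naturals can index the requirements,
    along the well-order given by CH. *)
Definition tree_code (t : tree) : set nat :=
  [set k | exists p x, k = pickle (p : seq nat, x : nat) /\ subtree t p = Some (leaf x)].

Lemma tree_codeE t p x :
  tree_code t (pickle (p, x)) <-> subtree t p = Some (leaf x).
Proof.
split=> [[q [y [/(pcan_inj pickleK)[-> ->]]]] //|tp].
by exists p, x.
Qed.

Lemma tree_code_inj : injective tree_code.
Proof.
move=> t u tu.
have {tu} : forall p x, subtree t p = Some (leaf x) <-> subtree u p = Some (leaf x).
  by move=> p x; rewrite -!tree_codeE tu.
elim: t u => [x|s IH] [y|s'] E.
- by have /(_ erefl)[->] := iffLR (E [::] x).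
- by have /(_ erefl) := iffLR (E [::] x).
- by have /(_ erefl) := iffRL (E [::] y).
- by congr fan; apply: funext => n; apply: IH => p x; apply: (E (n :: p)).
Qed.

Lemma contains_contour_tree U t a : inj_leaves t -> mono_rk t -> oeq (rk t) a ->
  tcontour t `<=` U -> contains_contour U a.
Proof.
move=> it mt ta tU; have [F ? Ft] := contour_of_tree it mt ta.
by exists F => //; apply: subset_trans tU.
Qed.

Lemma P_countable_nonempty a : continuum_hypothesis ->
  countable_ordinal a -> ole oone a -> P_countable a !=set0.
Proof.
move=> ch ca le1a; have [t [ct lta rt]] := increasing_contours ca le1a.
have ct_leq := increasing_leq ct.
pose F A := exists j, tcontour (t j) A.
have FP : ProperFilter F.
  split=> [[j /tcontour0 //]|]; split.
  - by exists 0; apply: filterT.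
  - move=> A B [i tA] [j tB]; exists (maxn i j); apply: tcontourI.
      by apply: ct_leq tA; apply: leq_maxl.
    by apply: ct_leq tB; apply: leq_maxr.
  - by move=> A B AB [j tA]; exists j; apply: tcontourS tA.
have [lt lt_wo lt_cnt] := ch_well_order ch.
(* The requirement at [X] is to kill the contour of the tree coded by [X], if that tree has rank
   [a]. *)
pose D X Y := forall w, tree_code w = X -> inj_leaves w -> mono_rk w ->
  oeq (rk w) a -> null w Y.
have [A dA pA X|U [UU FU DU]] := tower_ultrafilter (D := D) lt_wo lt_cnt FP.
  have [[w [wX iw mw wa]]|nw] := pselect (exists w,
    [/\ tree_code w = X, inj_leaves w, mono_rk w & oeq (rk w) a]); last first.
    exists setT => [w wX iw mw wa|n]; first by case: nw; exists w.
    by rewrite setTI.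
  have [j|j n tn|Y nY Ypos] := diagonal_union ct iw mw _ dA.
  - by apply: olt_ole_trans (lta j) _; case: wa.
  - by apply: (pA n); exists j.
  exists Y => [w' w'X _ _ _|n [j]]; last exact: Ypos.
  by rewrite (@tree_code_inj w' w) // w'X.
exists U; split=> // [[G /tree_of_contour[w [iw mw wa wG]] GU]|b le1b ltba].
  (* The complement of [Y] lies in [tcontour w], hence in [G] and in [U]. *)
  have [Y /(_ _ erefl iw mw wa) nY UY] := DU (tree_code w).
  apply: (@filter_not_empty _ U); rewrite -(setICr Y).
  by apply: filterI => //; apply/GU/wG.
have [j [t' [it' mt' t'b t't]]] := rt b le1b ltba.
apply: contains_contour_tree it' mt' t'b _ => A /t't tA.
by apply: FU; exists j.
Qed.

Lemma P_omega1_nonempty : P_omega1 !=set0.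
Proof.
pose F A := exists c, tcontour (ctree c) A.
have FP : ProperFilter F.
  split=> [[c /tcontour0 //]|]; split.
  - by exists code_zero; apply: filterT.
  - move=> A B [c cA] [d dB].
    (* The tree of [code_sup s] has larger rank than those of [c] and [d], so its contour contains
       both of theirs. *)
    pose s n := if n is 0 then c else d.
    have lt_s n : olt (rk (ctree (s n))) (rk (ctree (code_sup s))).
      apply: olt_ole_trans (proj2 (rk_ctree_sup s)).
      exact: (osup_gt (fun n => rk (ctree (s n)))).
    exists (code_sup s); apply: tcontourI.
      exact: ctree_chain (lt_s 0) _ cA.
    exact: ctree_chain (lt_s 1) _ dB.
  - by move=> A B AB [c cA]; exists c; apply: tcontourS cA.
have [U [UU FU]] := ultraFilterLemma FP.
exists U; split=> // b le1b /omega1P cb.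
have [c cb'] := ctree_rank_ex cb le1b.
apply: contains_contour_tree (inj_ctree c) (mono_ctree c) cb' _ => A cA.
by apply: FU; exists c.
Qed.

Theorem theorem6p5 :
  continuum_hypothesis ->
  forall a : Ord, ole oone a -> ole a omega1 -> P_class a !=set0.
Proof.
move=> ch a le1a lea1; have [le1|lta] := ole_total omega1 a.
  by have [U PU] := P_omega1_nonempty; exists U; right.
have [|U PU] := @P_countable_nonempty a ch _ le1a; first exact/omega1P.
by exists U; left.
Qed.
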